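(* Let $d\ge1$, let $h$ be a $d$-variate probability density function on $(\mathbb{R}^+)^d$ (the score density), and let $\nu^\star(\mathrm{d}z,\mathrm{d}x)=\rho^\star(\mathrm{d}z)\,\alpha(\mathrm{d}x)$ be a homogeneous Lévy intensity on $\mathbb{R}^+\times\mathbb{X}$ (the directing Lévy measure). For $j\in\{1,\dots,d\}$ let $S_j$ be a random variable distributed as the $j$-th marginal of $h$. Suppose that for every $j\in\{1,\dots,d\}$ and every bounded set $X\in\mathcal{X}$, $$\int_{(0,1)\times X}\mathbb{P}\left[S_j\ge \tfrac1z\right]\nu^\star(\mathrm{d}z,\mathrm{d}x)<\infty\quad\text{and}\quad\int_{[1,\infty)\times X}\mathbb{P}\left[S_j\le \tfrac1z\right]z\,\nu^\star(\mathrm{d}z,\mathrm{d}x)<\infty.$$ Consider the compound random measure with score density $h$ and directing Lévy measure $\nu^\star$, and let $\nu_j(\mathrm{d}s,\mathrm{d}x)=\rho_j(\mathrm{d}s)\,\alpha(\mathrm{d}x)$, $j=1,\dots,d$, be its marginal intensities. If $\rho^\star$ is regularly varying, then $\rho_j$ is regularly varying for every $j=1,\dots,d$.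
   Context: $\mathbb{R}^+=(0,\infty)$. $\mathbb{X}$ is a Polish space (with a fixed complete separable metric, with respect to which ''bounded'' is understood) with Borel $\sigma$-algebra $\mathcal{X}$. A Lévy intensity is a measure $\nu$ on $(\mathbb{R}^+\times\mathbb{X},\mathcal{B}(\mathbb{R}^+)\otimes\mathcal{X})$ such that $\int_{\mathbb{R}^+\times X}\min\{1,s\}\,\nu(\mathrm{d}s,\mathrm{d}x)<\infty$ for every bounded $X\in\mathcal{X}$; it is homogeneous if it is of the form $\rho(\mathrm{d}s)\,\alpha(\mathrm{d}x)$ with $\rho$ a measure on $(\mathbb{R}^+,\mathcal{B}(\mathbb{R}^+))$ and $\alpha$ a measure on $(\mathbb{X},\mathcal{X})$. A compound random measure (CoRM) with score density $h$ and directing Lévy measure $\nu^\star$ is a vector of $d$ completely random measures with multivariate Lévy intensity $\tilde\nu_d(\mathrm{d}\boldsymbol{s},\mathrm{d}x)=\int_{\mathbb{R}^+}z^{-d}h(s_1/z,\dots,s_d/z)\,\mathrm{d}\boldsymbol{s}\,\nu^\star(\mathrm{d}z,\mathrm{d}x)$. Its $j$-th marginal $\nu_j$ is obtained by integrating out all $s_i$, $i\ne j$; in the homogeneous case $\nu_j(\mathrm{d}s,\mathrm{d}x)=\rho_j(\mathrm{d}s)\,\alpha(\mathrm{d}x)$ with $\rho_j(A)=\int_{\mathbb{R}^+}\mathbb{P}[zS_j\in A]\,\rho^\star(\mathrm{d}z)$ for Borel $A\subseteq\mathbb{R}^+$. A real-valued function $L$ is slowly varying if $\lim_{t\to\infty}L(at)/L(t)=1$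 for all $a>0$. A homogeneous Lévy measure $\rho(\mathrm{d}s)\,\alpha(\mathrm{d}x)$ (or simply $\rho$) is regularly varying if its tail integral $U(y)=\int_y^\infty\rho(\mathrm{d}s)$, $y>0$, satisfies $U(y)=L(1/y)\,y^{-\sigma}$ for some $\sigma\in[0,1)$ (the index) and some slowly varying function $L$. *)

(* Defs.v *)
From HB Require Import structures.
From mathcomp Require Import all_boot all_order all_algebra.
From mathcomp Require Import all_classical all_reals all_analysis.

Set Implicit Arguments.
Unset Strict Implicit.
Unset Printing Implicit Defensive.

Import Order.TTheory GRing.Theory Num.Theory.
Import numFieldNormedType.Exports.

Local Open Scope classical_set_scope.
Local Open Scope ring_scope.

HB.mixin Record isSeparable T & Topological T := {
  separable : exists D : set T, countable D /\ dense D }.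

(* A Polish space with a fixed complete metric [mdist]. The base point is what
   [g_sigma_algebraType] requires; it only excludes the empty space. *)
#[short(type="polishType")]
HB.structure Definition Polish (R : numDomainType) :=
  { T of Metric R T & Complete T & Pointed T & isSeparable T }.

Notation borel X := (g_sigma_algebraType (@open X)).

Definition metric_bounded (R : realType) (X : metricType R) (B : set X) :=
  exists M : R, forall x y, B x -> B y -> mdist x y <= M.

Section lebesgue_tuple.
Context {R : realType}.

(* [lebesgue_measure] lives on [measurableTypeR R], which has the same
   measurable sets as [R] but another display; [tcons] is where the two meet. *)
Definition tcons n (p : measurableTypeR R * n.-tuple R) : n.+1.-tuple R :=
  [tuple of (p.1 : R) :: p.2].

Definition tuncons n (s : n.+1.-tuple R) : measurableTypeR R * n.-tuple R :=
  (thead s, [tuple of behead s]).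

Lemma tconsK n : cancel (@tcons n) (@tuncons n).
Proof.
by move=> [x s]; congr (_, _); exact: val_inj.
Qed.

Lemma measurable_tcons n : measurable_fun setT (@tcons n).
Proof.
apply: (@measurable_cons _ _ _ _ (fun p => p.1) n (fun p => p.2)).
  exact: measurable_fst.
exact: measurable_snd.
Qed.

Lemma measurable_tuncons n : measurable_fun setT (@tuncons n).
Proof.
apply: measurable_fun_pair; last exact: measurable_behead.
exact: (measurable_tnth ord0).
Qed.

Section lebesgue_tcons.
Variables (n : nat) (m : {sigma_finite_measure set (n.-tuple R) -> \bar R}).

Definition lebesgue_tcons : set (n.+1.-tuple R) -> \bar R :=
  pushforward (lebesgue_measure \x m)%E (@tcons n).

Let mpre A : measurable A -> measurable (@tcons n @^-1` A).
Proof. by move=> mA; rewrite -[X in measurable X]setTI; exact: measurable_tcons. Qed.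

Let lebesgue_tcons0 : lebesgue_tcons set0 = 0%E.
Proof. by rewrite /lebesgue_tcons /pushforward preimage_set0 measure0. Qed.

Let lebesgue_tcons_ge0 A : (0 <= lebesgue_tcons A)%E.
Proof. by rewrite /lebesgue_tcons /pushforward measure_ge0. Qed.

Let lebesgue_tcons_sigma_additive : semi_sigma_additive lebesgue_tcons.
Proof.
move=> F mF tF mUF; rewrite /lebesgue_tcons /pushforward preimage_bigcup.
apply: measure_semi_sigma_additive.
- by move=> k; exact: mpre.
- apply/trivIsetP => /= i j _ _ ij; rewrite -preimage_setI.
  by move/trivIsetP : tF => /(_ _ _ _ _ ij) ->//; rewrite preimage_set0.
- by rewrite -preimage_bigcup; exact: mpre.
Qed.

HB.instance Definition _ := isMeasure.Build _ _ _ lebesgue_tcons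
  lebesgue_tcons0 lebesgue_tcons_ge0 lebesgue_tcons_sigma_additive.

Let lebesgue_tcons_sigma_finite : sigma_finite setT lebesgue_tcons.
Proof.
have /sigma_finiteP[F [TF ndF Foo]] := sigma_finiteT (@lebesgue_measure R).
have /sigma_finiteP[G [TG ndG Goo]] := sigma_finiteT m.
exists (fun k => @tuncons n @^-1` (F k `*` G k)).
  rewrite -preimage_bigcup (_ : \bigcup_k _ = setT) ?preimage_setT//.
  apply/seteqP; split => // -[x s] _.
  have [i _ Fix] : (\bigcup_i F i) x by rewrite -TF.
  have [j _ Gjs] : (\bigcup_j G j) s by rewrite -TG.
  exists (maxn i j) => //; split => /=.
    by move: x Fix; exact/subsetPset/ndF/leq_maxl.
  by move: s Gjs; exact/subsetPset/ndG/leq_maxr.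
move=> k; have [mF Fk] := Foo k; have [mG Gk] := Goo k; split.
  rewrite -[X in measurable X]setTI; apply: measurable_tuncons => //.
  exact: measurableX.
rewrite /lebesgue_tcons /pushforward -comp_preimage.
rewrite (_ : _ \o _ = id); last by apply/funext => p /=; exact: tconsK.
by rewrite preimage_id product_measure1E// lte_mul_pinfty// ge0_fin_numE.
Qed.

HB.instance Definition _ := Measure_isSigmaFinite.Build _ _ _ lebesgue_tcons
  lebesgue_tcons_sigma_finite.

End lebesgue_tcons.

Fixpoint lebesgue_tuple n : {sigma_finite_measure set (n.-tuple R) -> \bar R} :=
  match n with
  | 0 => \d_[tuple]
  | n'.+1 => lebesgue_tcons (lebesgue_tuple n')
  end.

Lemma lebesgue_tuple_box n (A : 'I_n -> set R) :
    (forall i, measurable (A i)) ->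
  (lebesgue_tuple n [set s | forall i, A i (tnth s i)] =
   \prod_(i < n) lebesgue_measure (A i))%E.
Proof.
elim: n A => [|n IH] A mA.
  rewrite big_ord0 /= diracE mem_set//= => -[].
by [].
rewrite big_ord_recl -IH; last by move=> i; exact: mA.
rewrite /= /lebesgue_tcons /pushforward -product_measure1E//; last 2 first.
- exact: mA.
- rewrite (_ : [set _ | _] =
      \bigcap_(i in setT) (@tnth _ R ^~ i @^-1` A (lift ord0 i))).
    apply: fin_bigcap_measurable => // i _.
    by rewrite -[X in measurable X]setTI; exact: measurable_tnth.
  by apply/seteqP; split => [s sA i _|s sA i]; [exact: sA|exact: (sA i I)].
congr (_ _); apply/seteqP; split => [[x s] /= As|[x s] /= [Ax As] i].
  split; first by have := As ord0.
  by move=> i; have := As (lift ord0 i); rewrite tnthS.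
by case: (unliftP ord0 i) => [j ->|->]; rewrite ?tnthS.
Qed.

End lebesgue_tuple.

Arguments lebesgue_tuple {R} n.

Section levy_intensities.
Context {R : realType} {X : polishType R}.
Implicit Types (nu : set (R * borel X) -> \bar R) (rho : set R -> \bar R)
  (alpha : set (borel X) -> \bar R).

(* Measures on (0, +oo) and on (0, +oo) * X are represented by measures on R
   and on R * X giving no mass to the complement. *)
Definition levy_intensity nu :=
  nu (~` (`]0, +oo[ `*` setT)) = 0%E /\
  forall B : set (borel X), measurable B -> metric_bounded (B : set X) ->
    (\int[nu]_(p in `]0%R, +oo[ `*` B) (Num.min 1 p.1)%:E < +oo)%E.

Definition homogeneous nu rho alpha :=
  rho (~` `]0, +oo[) = 0%E /\
  forall (A : set R) (B : set (borel X)), measurable A -> measurable B ->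
    nu (A `*` B) = (rho A * alpha B)%E.

End levy_intensities.

Section compound_random_measures.
Context {R : realType} {X : polishType R} {d : nat}.

Definition positive_orthant : set (d.-tuple R) :=
  [set s | forall i, 0 < tnth s i].

(* Only the values of [h] on the positive orthant are relevant. *)
Definition score_density (h : d.-tuple R -> R) :=
  [/\ measurable_fun positive_orthant h,
      (forall s, positive_orthant s -> 0 <= h s) &
      (\int[lebesgue_tuple d]_(s in positive_orthant) (h s)%:E = 1)%E].

Definition marginal_law (h : d.-tuple R -> R) (j : 'I_d) (A : set R) : \bar R :=
  (\int[lebesgue_tuple d]_(s in positive_orthant `&` [set s | A (tnth s j)])
     (h s)%:E)%E.

Definition corm_intensity (h : d.-tuple R -> R) (nu : set (R * borel X) -> \bar R)
    (E : set (d.-tuple R * borel X)) : \bar R :=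
  (\int[nu]_(p in `]0%R, +oo[ `*` setT)
     \int[lebesgue_tuple d]_(s in positive_orthant `&` [set s | E (s, p.2)])
       (p.1 ^- d * h (map_tuple (fun t => t / p.1) s))%:E)%E.

Definition corm_marginal (h : d.-tuple R -> R) (nu : set (R * borel X) -> \bar R)
    (j : 'I_d) (E : set (R * borel X)) : \bar R :=
  corm_intensity h nu [set q | E (tnth q.1 j, q.2)].

End compound_random_measures.

Section regular_variation.
Context {R : realType}.

Definition slowly_varying (L : R -> R) :=
  forall a : R, 0 < a -> L (a * t) / L t @[t --> +oo] --> (1 : R).

Definition tail_integral (rho : set R -> \bar R) (y : R) : \bar R :=
  rho `]y, +oo[%classic.

Definition regularly_varying (rho : set R -> \bar R) :=
  exists sigma : R, 0 <= sigma < 1 /\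
  exists L : R -> R, slowly_varying L /\
    forall y, 0 < y -> tail_integral rho y = (L y^-1 * y `^ (- sigma))%:E.

End regular_variation.

(* Main.v *)
(** Write V(x) = rho ]1/x, +oo[ for x > 0, and V(x) = 0 for x <= 0. Tonelli's
    theorem turns the tail of rho_j into a mixture: its value at 1/t is
    m(t) = E[V(t S_j)]. Fix a > 0 and e > 0. As V is monotone and
    V(ax)/V(x) -> a^sigma, there are M and K such that, for every x,
    |V(ax) - a^sigma V(x)| <= e V(x) + K 1_{x <= M}. Taking x = t S_j and
    integrating, |m(at) - a^sigma m(t)| <= e m(t) + K P[t S_j <= M], where the
    last probability tends to 0 because S_j > 0, while m(t) is eventually at
    least V(M)/2. Hence m(at)/m(t) -> a^sigma. Finiteness of m(1) is the first
    integrability assumption; the pointwise bound extends it to every m(t). *)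
From HB Require Import structures.
Require Import Defs.
From mathcomp Require Import all_boot all_order all_algebra.
From mathcomp Require Import all_classical all_reals all_analysis.
From mathcomp Require Import measurable_realfun lra.
Import Order.TTheory GRing.Theory Num.Theory.
Import numFieldNormedType.Exports.
Local Open Scope classical_set_scope.
Local Open Scope ring_scope.

(** * Scaling of Lebesgue measure in one and in several dimensions *)

Lemma lebesgue_measure_scale {R : realType} (z : R)
    (A : set (measurableTypeR R)) :
  0 < z -> measurable A ->
  lebesgue_measure ((fun x => x / z) @^-1` A) =
    (z%:E * lebesgue_measure A)%E.
Proof.
move=> z0 mA; pose phi (x : measurableTypeR R) : measurableTypeR R := x / z.
have mf : measurable_fun [set: measurableTypeR R]
    phi.
  exact: measurable_funM.
have zV0 : 0 <= z^-1 by rewrite invr_ge0 ltW.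
(* The rescaled image measure [mu] agrees with Lebesgue measure on half-open intervals, so
   uniqueness identifies the two on all measurable sets. *)
pose mu := mscale (NngNum zV0)
  (pushforward (lebesgue_measure : {measure set (measurableTypeR R) -> \bar R}) phi).
rewrite [lebesgue_measure A](@lebesgue_measure_unique R (mu mf))//; last first.
  move=> _ [[a b] _ <-].
  transitivity ((z^-1)%:E * lebesgue_measure (phi @^-1` `]a, b]))%E; last by [].
  rewrite (_ : _ @^-1` _ = `]a * z, b * z]%classic); last first.
    by apply/seteqP; split => x /=; rewrite !in_itv/= ltr_pdivlMr// ler_pdivrMr.
  rewrite !lebesgue_measure_itv/= !lte_fin ltr_pM2r//.
  case: ifPn => _; last by rewrite mule0.
  rewrite -!EFinD -EFinM; congr EFin.
  by rewrite -mulrBl mulrC mulfK ?gt_eqF.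
transitivity (z%:E * ((z^-1)%:E * lebesgue_measure (phi @^-1` A)))%E; last by [].
by rewrite muleA -EFinM divff ?gt_eqF// mul1e.
Qed.

Lemma ge0_integral_lebesgue_scale {R : realType} (z : R)
    (f : measurableTypeR R -> \bar R) :
  0 < z -> measurable_fun setT f -> (forall x, 0 <= f x)%E ->
  (\int[lebesgue_measure]_x f ((x : R) / z)%R =
   z%:E * \int[lebesgue_measure]_x f x)%E.
Proof.
move=> z0 mf f0; pose phi (x : measurableTypeR R) : measurableTypeR R := x / z.
have mphi : measurable_fun setT phi by exact: measurable_funM.
have z0' := ltW z0.
rewrite -[RHS](@ge0_integral_mscale _ _ _ _ _ measurableT (NngNum z0'))//.
transitivity (\int[pushforward lebesgue_measure phi]_x f x)%E.
  by rewrite ge0_integral_pushforward.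
apply: (@eq_measure_integral _ _ _ _ (mscale (NngNum z0') lebesgue_measure)
  (measure_function_pushforward__canonical__measure_function_Measure
     lebesgue_measure mphi)) => A mA _.
exact: lebesgue_measure_scale.
Qed.

Lemma measurable_map_scale {R : realType} n (z : R) :
  measurable_fun [set: n.-tuple R] (map_tuple (fun t : R => t / z)).
Proof.
apply/measurable_fun_tnthP => i.
rewrite (_ : _ \o _ = (fun s : n.-tuple R => tnth s i / z)); last first.
  by apply/funext => s /=; rewrite tnth_map.
by apply: measurable_funM => //; exact: measurable_tnth.
Qed.

(** Induction on the dimension: the sections of the preimage are preimages of sections at [x / z],
    which gives [z ^+ n] by induction, and the change of variable in the first coordinate gives one
    more factor [z]. *)
Lemma lebesgue_tuple_scale {R : realType} n (z : R) (A : set (n.-tuple R)) :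
  0 < z -> measurable A ->
  lebesgue_tuple n (map_tuple (fun t => t / z) @^-1` A) =
    ((z ^+ n)%:E * lebesgue_tuple n A)%E.
Proof.
move=> z0; elim: n A => [|n IH] A mA.
  rewrite expr0 mul1e; congr (_ _); apply/funext => s.
  by congr (A _); rewrite [RHS]tuple0 [LHS]tuple0.
rewrite /= /lebesgue_tcons /pushforward /product_measure1.
have mB : measurable (@tcons R n @^-1` A).
  by rewrite -[X in measurable X]setTI; exact: measurable_tcons.
pose f (x : measurableTypeR R) :=
  lebesgue_tuple n (xsection (@tcons R n @^-1` A) x).
have mf : measurable_fun setT f by exact: measurable_fun_xsection.
transitivity (\int[lebesgue_measure]_x ((z ^+ n)%:E * f ((x : R) / z)%R))%E.
  apply: eq_integral => x _; rewrite -IH; last exact: measurable_xsection.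
  have tconsE s : map_tuple (fun t : R => t / z) (tcons (x, s)) =
      tcons (x / z, map_tuple (fun t => t / z) s) by exact: val_inj.
  rewrite /=; set B := xsection _ _; set C := _ @^-1` _.
  suff -> : B = C by [].
  by apply/funext => s; rewrite /B /C /xsection/= !inE/= tconsE.
have mfz : measurable_fun setT (fun x : measurableTypeR R => f ((x : R) / z)).
  apply: (measurableT_comp mf (f := f)
    (g := (fun x => x / z) : measurableTypeR R -> measurableTypeR R)).
  exact: measurable_funM.
rewrite ge0_integralZl_EFin// ?exprn_ge0 ?(ltW z0)//.
by rewrite ge0_integral_lebesgue_scale// muleA -EFinM -exprSr.
Qed.

Lemma ge0_integral_lebesgue_tuple_scale {R : realType} n (z : R)
    (D : set (n.-tuple R)) (f : n.-tuple R -> \bar R) :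
  0 < z -> measurable D -> measurable_fun D f ->
  (forall s, D s -> 0 <= f s)%E ->
  (\int[lebesgue_tuple n]_(s in map_tuple (fun t => t / z)%R @^-1` D)
      f (map_tuple (fun t => t / z)%R s) =
   (z ^+ n)%:E * \int[lebesgue_tuple n]_(s in D) f s)%E.
Proof.
move=> z0 mD mf f0; have zn0 : 0 <= z ^+ n by rewrite exprn_ge0// ltW.
have mphi := @measurable_map_scale R n z.
set phi := map_tuple _ in mphi *.
rewrite -[RHS](@ge0_integral_mscale _ _ _ _ _ mD (NngNum zn0))//.
transitivity (\int[pushforward (lebesgue_tuple n) phi]_(s in D) f s)%E.
  by rewrite ge0_integral_pushforward// => s; rewrite inE; exact: f0.
apply: (@eq_measure_integral _ _ _ _ (mscale (NngNum zn0) (lebesgue_tuple n))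
  (measure_function_pushforward__canonical__measure_function_Measure
     (lebesgue_tuple n) mphi)) => A mA _.
exact: lebesgue_tuple_scale.
Qed.

(** * Marginal intensities on rectangles, and integrals against homogeneous intensities *)

Lemma measurable_positive_orthant {R : realType} d :
  measurable (@positive_orthant R d).
Proof.
rewrite (_ : positive_orthant = \bigcap_(i in [set: 'I_d])
    (fun s : d.-tuple R => tnth s i) @^-1` `]0, +oo[).
  apply: fin_bigcap_measurable => // i _.
  by rewrite -[X in measurable X]setTI; apply: measurable_tnth => //.
apply/seteqP; split => [s s0 i _|s s0 i]; rewrite /= ?in_itv/= ?andbT.
  exact: s0.
by have := s0 i I; rewrite /= in_itv/= andbT.
Qed.

(* Substituting s = z u cancels the factor z^-d, so the s_j-marginal of the
   scaled density is the law of z S_j. *)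
Lemma score_integral_scale {R : realType} d (h : d.-tuple R -> R) (j : 'I_d)
    (z : R) (A : set R) :
  score_density h -> 0 < z -> measurable A ->
  (\int[lebesgue_tuple d]_(s in positive_orthant `&` [set s | A (tnth s j)])
      (z ^- d * h (map_tuple (fun t => t / z) s))%:E)%E =
  marginal_law h j [set t | A (z * t)].
Proof.
move=> [mh h0 _] z0 mA; set D := positive_orthant `&` [set s | A (z * tnth s j)].
have mO := @measurable_positive_orthant R d.
have mD : measurable D.
  apply: measurableI => //.
  rewrite -[X in measurable X]setTI.
  have mt := @measurable_tnth _ R d j.
  exact: (measurable_funM (@measurable_cst _ _ _ _ setT z) mt).
have mhD : measurable_fun D h by apply: (measurable_funS mO) mh => s [].
have hD s : D s -> 0 <= h s by move=> [/h0].
rewrite (_ : _ `&` _ = map_tuple (fun t => t / z) @^-1` D); last first.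
  apply/seteqP; split => s [s0 sA]; split => [i|/=].
  - by rewrite tnth_map divr_gt0// s0.
  - by rewrite tnth_map mulrC divfK ?gt_eqF.
  - by have := s0 i; rewrite tnth_map pmulr_lgt0// invr_gt0.
  - by move: sA; rewrite /= tnth_map mulrC divfK ?gt_eqF.
have mphi := @measurable_map_scale R d z.
have mphiD : measurable (map_tuple (fun t => t / z) @^-1` D).
  by rewrite -[X in measurable X]setTI; exact: mphi.
under eq_integral do rewrite EFinM.
rewrite ge0_integralZl_EFin//; last 3 first.
- by move=> s sD; rewrite lee_fin; exact: hD.
- apply/measurable_EFinP.
  apply: (measurable_comp mD) => //; first by move=> _ [s sD <-].
  exact: measurable_funTS.
- by rewrite invr_ge0 exprn_ge0// ltW.
rewrite (ge0_integral_lebesgue_tuple_scale d z D (EFin \o h))//; last first.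
- exact/measurable_EFinP.
by rewrite muleA -EFinM mulVf ?mul1e// expf_neq0// gt_eqF.
Qed.

Lemma corm_marginal_rectangle {R : realType} {X : polishType R} {d : nat}
    (h : d.-tuple R -> R) (nu : {measure set (R * borel X) -> \bar R}) (j : 'I_d)
    (A : set R) (B : set (borel X)) :
  score_density h -> measurable A ->
  corm_marginal h nu j (A `*` B) =
  (\int[nu]_(p in `]0%R, +oo[ `*` B) marginal_law h j [set t | A (p.1 * t)%R])%E.
Proof.
move=> hh mA; rewrite /corm_marginal /corm_intensity.
rewrite [LHS]integral_mkcond [RHS]integral_mkcond; apply: eq_integral => p _.
rewrite !patchE; have [pS|pS] := boolP (p \in `]0, +oo[ `*` setT); last first.
  rewrite memNset// => -[p1 p2]; move: pS => /negP; apply.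
  by rewrite inE; split.
have {}pS : 0 < p.1 by move: pS; rewrite inE/= in_itv/= andbT => -[].
have [pB|pB] := pselect (B p.2).
  rewrite mem_set; last by split => //=; rewrite in_itv/= pS.
  rewrite -score_integral_scale//; congr (integral _ _ _).
  by apply/seteqP; split => s [s0 sA]; split => //=; case: sA.
rewrite memNset; last by case.
rewrite (_ : _ `&` _ = set0) ?integral_set0//.
by apply/seteqP; split => // s [_ [_ /= /pB]].
Qed.

(** Homogeneity gives [nu] on rectangles only, and no Fubini theorem is invoked: [nu] restricted to
    the strip over [B] and projected to the first coordinate is the measure [alpha B] times [rho].
    Finiteness of [alpha B] makes it a legitimate scalar. *)
Lemma ge0_integral_homogeneous {R : realType} {X : polishType R}
    (nu : {measure set (R * borel X) -> \bar R}) (rho : {measure set R -> \bar R})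
    (alpha : {measure set (borel X) -> \bar R})
    (D : set R) (B : set (borel X)) (g : R -> \bar R) :
  homogeneous nu rho alpha -> measurable D -> measurable B ->
  (alpha B < +oo)%E -> measurable_fun D g -> (forall z, D z -> 0 <= g z)%E ->
  (\int[nu]_(p in D `*` B) g p.1 = alpha B * \int[rho]_(z in D) g z)%E.
Proof.
move=> [_ nuE] mD mB Boo mg g0.
have mTB : measurable ([set: R] `*` B) by exact: measurableX.
pose nuB : {measure set (R * borel X) -> \bar R} := mrestr nu mTB.
have mDT : measurable (fst @^-1` D : set (R * borel X)).
  by rewrite -[X in measurable X]setTI; exact: measurable_fst.
have mN : measurable ([set: R] `*` ~` B) by apply: measurableX => //; exact: measurableC.
have alphaB_fin : alpha B \is a fin_num by rewrite ge0_fin_numE.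
have alphaB0 : 0 <= fine (alpha B) by rewrite fine_ge0.
have mgfst : measurable_fun (fst @^-1` D) (g \o (@fst R (borel X))).
  by apply: (measurable_comp mD) => //; [move=> _ [p Dp <-]|exact: measurable_funTS].
transitivity (\int[nuB]_(p in D `*` B) g p.1)%E.
  apply: eq_measure_integral => E mE EDB.
  rewrite /= /mrestr setIidl// => p /EDB[_ Bp]; by split.
transitivity (\int[nuB]_(p in fst @^-1` D) g p.1)%E.
  (* The complement of the strip is null for [nuB], so integrating over [D] times [B] or over the
     whole cylinder above [D] is the same. *)
  rewrite [RHS](ge0_negligible_integral mN)//; last 2 first.
  - by move=> p; exact: g0.
  - rewrite /nuB /= /mrestr (_ : _ `&` _ = set0) ?measure0//.
    by apply/seteqP; split => // -[x y] [[_ ?] [_ ?]].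
  congr (integral _ _ _); apply/seteqP; split => -[x y] /=.
    by move=> [Dx By]; split => //; case.
  move=> [Dx By]; split => //; apply: contrapT => nBy; apply: By; split => //.
rewrite -[X in (X * _)%E](fineK alphaB_fin).
rewrite -[RHS](@ge0_integral_mscale _ _ _ _ _ mD (NngNum alphaB0))//.
transitivity (\int[pushforward nuB fst]_(z in D) g z)%E.
  by rewrite ge0_integral_pushforward// => z; rewrite inE; exact: g0.
apply: (@eq_measure_integral _ _ _ _ (mscale (NngNum alphaB0) rho)
  (measure_function_pushforward__canonical__measure_function_Measure
     nuB measurable_fst)) => E mE _.
transitivity (nu (E `*` B)); last first.
  by rewrite nuE// muleC -{1}(fineK alphaB_fin).
rewrite /pushforward/= /pushforward /nuB /= /mrestr; congr (nu _).
by apply/seteqP; split => -[x y] /=; [move=> [? []]|move=> []].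
Qed.

(** * Metric balls and bounded sets of positive mass *)

Lemma metric_bounded_ball {R : realType} {X : polishType R} (x : X) (r : R) :
  metric_bounded (ball x r).
Proof.
exists (r + r) => y z; rewrite !ballEmdist /= => xy xz.
rewrite (le_trans (metric_triangle _ x _))// lerD// ?ltW//.
by rewrite metric_sym.
Qed.

Lemma open_metric_ball {R : realType} {X : metricType R} (x : X) (r : R) :
  open (ball x r).
Proof.
rewrite openE => y; rewrite ballEmdist/= => xy.
apply/nbhs_ballP; exists (r - mdist x y); first by rewrite /= subr_gt0.
move=> z; rewrite !ballEmdist/= => yz.
by rewrite (le_lt_trans (metric_triangle x y z))// -ltrBrDl.
Qed.

(** Balls of integer radius around the base point cover the space; were they all null, countable
    subadditivity would make [alpha] vanish. *)
Lemma exists_bounded_measure_gt0 {R : realType} {X : polishType R}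
    (alpha : {measure set (borel X) -> \bar R}) :
  (0 < alpha setT)%E ->
  exists B : set (borel X),
    [/\ measurable B, metric_bounded (B : set X) & (0 < alpha B)%E].
Proof.
move=> aT; apply: contrapT => noB.
have mB n : measurable (ball (point : X) n%:R : set (borel X)).
  by apply: sub_sigma_algebra; exact: open_metric_ball.
move: aT; rewrite (_ : setT = \bigcup_n (ball (point : X) n%:R)); last first.
  apply/seteqP; split => // y _.
  exists (Num.truncn (mdist (point : X) y)).+1 => //.
  by rewrite ballEmdist/=; exact: truncnS_gt.
rewrite ltNge => /negP; apply.
rewrite (le_trans (generalized_Boole_inequality alpha mB _))//.
  exact: bigcup_measurable.
rewrite eseries0// => n _ _; apply/eqP; rewrite eq_le measure_ge0 andbT.
by rewrite leNgt; apply/negP => a0; apply: noB; exists (ball (point : X) n%:R);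
  split => //; exact: metric_bounded_ball.
Qed.

(** * Ratio limits of a monotone function averaged over a scaled random variable *)

Lemma ratio_cvg_pointwise {R : realType} (V : R -> R) (a b e x0 : R) :
  0 < a -> {homo V : x y / x <= y} -> (forall x, 0 <= V x) -> 0 < V x0 ->
  V (a * x) / V x @[x --> +oo] --> b -> 0 < e ->
  exists M K, [/\ 0 < M, 0 < V M, 0 <= K &
    forall x, `|V (a * x) - b * V x| <= e * V x + K * \1_(`]-oo, M]) x].
Proof.
move=> a0 ndV V0 Vx0 /cvgrPdist_le cvgV e0.
have [M1 [_ HM1]] := cvgV _ e0.
(* The three entries make [M] positive, put it beyond the threshold of the limit, and ensure
   [0 < V M]. Below [M] monotonicity bounds both terms by their values at [M], whence the choice of
   [K]. *)
pose M := Num.max 1 (Num.max M1 x0).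
have M_gt0 : 0 < M by rewrite lt_max ltr01.
have VM0 : 0 < V M by rewrite (lt_le_trans Vx0)// ndV// !le_max lexx !orbT.
exists M, (V (a * M) + `|b| * V M); split => //; first by rewrite addr_ge0// mulr_ge0.
move=> x; rewrite indicE; have [xM|xM] := leP x M.
  rewrite mem_set/= ?in_itv//= mulr1.
  rewrite (le_trans (ler_normB _ _))// normrM (ger0_norm (V0 (a * x))) (ger0_norm (V0 x)).
  apply: ler_wpDl; first by rewrite mulr_ge0// ltW.
  apply: lerD; first by apply: ndV; rewrite ler_pM2l.
  by rewrite ler_wpM2l//; exact: ndV.
rewrite memNset/= ?in_itv/= ?(lt_geF xM)// mulr0 addr0.
have Vx : 0 < V x by rewrite (lt_le_trans VM0)// ndV// ltW.
have M1x : M1 < x by rewrite (le_lt_trans _ xM)// !le_max lexx orbT.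
have := HM1 x M1x.
rewrite distrC -(ler_pM2r Vx) -{2}(gtr0_norm Vx) -normrM mulrBl divfK ?gt_eqF//.
Qed.

(** The probability is at most the distribution function of [T] at a point decreasing to 0 as [t]
    grows; right continuity there and [cdf T 0 = 0] conclude. *)
Lemma cvg_scaled_cdf0 {R : realType} {d} {Omega : measurableType d}
    (P : probability Omega R) (T : {RV P >-> R}) (M e : R) :
  P [set w | T w <= 0] = 0%E -> 0 < e -> 
  \forall t \near +oo, fine (P [set w | t * T w <= M]) < e.
Proof.
move=> T0 e0.
have := @cdf_right_continuous _ _ _ P T 0.
rewrite (_ : cdf T 0 = 0%E); last by rewrite -T0 /cdf/distribution/pushforward;
  congr (P _); apply/seteqP; split => w /=; rewrite in_itv.
move=> /fine_cvg /cvgrPdist_lt /(_ _ e0) [r /= r0 Hr].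
near=> t.
have t0 : 0 < t by near: t; exact: nbhs_pinfty_gt.
(* The maximum with 1 keeps [s] strictly positive for any real [M], as the right limit at 0
   requires. *)
pose s := (Num.max 1 M) / t.
have s0 : 0 < s by rewrite divr_gt0// lt_max ltr01.
have sr : `|0 - s| < r.
  rewrite sub0r normrN gtr0_norm// ltr_pdivrMr// mulrC -ltr_pdivrMr//.
  by near: t; apply: nbhs_pinfty_gt; exact: num_real.
have := Hr s sr s0; rewrite sub0r normrN; apply: le_lt_trans.
have mtT : measurable [set w | t * T w <= M].
  rewrite (_ : mkset _ = (fun w => t * T w) @^-1` `]-oo, M]); last first.
    by apply/seteqP; split => w /=; rewrite in_itv.
  rewrite -[X in measurable X]setTI.
  have mtT : measurable_fun setT (fun w => t * T w) by exact: measurable_funM.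
  exact: mtT.
have mTs : measurable (T @^-1` `]-oo, s]).
  rewrite -[X in measurable X]setTI; exact: measurable_funP.
rewrite ger0_norm ?fine_ge0//; apply: fine_le.
- exact: fin_num_measure.
- exact: fin_num_measure.
rewrite /cdf /distribution /pushforward le_measure ?inE// => w /=.
rewrite in_itv/= /s => tTM; rewrite ler_pdivlMr// mulrC (le_trans tTM)//.
by rewrite le_max lexx orbT.
Unshelve. all: end_near.
Qed.

(** The pointwise bound with [e = 1] dominates [V (a * T)] by an affine function of [V (T)], which
    is integrable because [P] is finite. *)
Lemma integrable_scaled {R : realType} {d} {Omega : measurableType d}
    (P : probability Omega R) (T : {RV P >-> R}) (V : R -> R) (a b x0 : R) :
  0 < a -> {homo V : x y / x <= y} -> (forall x, 0 <= V x) -> 0 < V x0 ->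
  V (a * x) / V x @[x --> +oo] --> b ->
  P.-integrable setT (EFin \o (fun w => V (T w))) ->
  P.-integrable setT (EFin \o (fun w => V (a * T w))).
Proof.
move=> a0 ndV V0 Vx0 cvgV intV.
have [M [K [_ _ K0 HVK]]] := ratio_cvg_pointwise V a b 1 x0 a0 ndV V0 Vx0 cvgV ltr01.
have mV : measurable_fun setT V by exact: nondecreasing_measurable.
have mT : measurable_fun setT T by exact: measurable_funP.
apply: (@le_integrable _ _ _ P setT measurableT _
    (EFin \o (fun w => (1 + `|b|) * V (T w) + K))).
- apply/measurable_EFinP; apply: measurableT_comp => //; exact: measurable_funM.
- move=> w _; rewrite /= lee_fin ger0_norm// ger0_norm; last first.
    by rewrite addr_ge0// mulr_ge0// addr_ge0.
  have := le_trans (ler_norm _) (HVK (T w)).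
  have : K * \1_(`]-oo, M]) (T w) <= K.
    by rewrite ler_piMr// indicE; case: (_ \in _).
  have : b * V (T w) <= `|b| * V (T w) by rewrite ler_wpM2r// ler_norm.
  by lra.
- have intc := finite_measure_integrable_cst P K measurableT.
  exact: (integrableD measurableT (integrableZl measurableT _ intV) intc).
Qed.

Lemma mixture_ratio_cvg {R : realType} {d} {Omega : measurableType d}
    (P : probability Omega R) (T : {RV P >-> R}) (V : R -> R) (a b x0 : R) :
  0 < a -> {homo V : x y / x <= y} -> (forall x, 0 <= V x) -> 0 < V x0 ->
  V (a * x) / V x @[x --> +oo] --> b ->
  P [set w | T w <= 0] = 0%E ->
  (forall t, 0 < t -> P.-integrable setT (EFin \o (fun w => V (t * T w)))) ->
  (\int[P]_w V (a * t * T w)) / (\int[P]_w V (t * T w)) @[t --> +oo] --> b.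
Proof.
move=> a0 ndV V0 Vx0 cvgV PT0 intV.
apply/cvgrPdist_le => e e0.
have e20 : 0 < e / 2 by rewrite divr_gt0.
have [M [K [M0 VM0 K0 HVK]]] :=
  ratio_cvg_pointwise V a b (e / 2) x0 a0 ndV V0 Vx0 cvgV e20.
(* The entry [1 / 2] turns [bot] into [V M / 2 <= mt]; the other makes [K * fine (P D)] at most
   [e / 2] times that lower bound, hence at most [e / 2 * mt]. Dividing by [K + 1] covers
   [K = 0]. *)
pose del := Num.min (1 / 2) (e / 2 * (V M / 2) / (K + 1)).
have K10 : 0 < K + 1 by rewrite ltr_wpDl.
have del0 : 0 < del by rewrite lt_min !divr_gt0// mulr_gt0// divr_gt0.
near=> t.
have t0 : 0 < t by near: t; exact: nbhs_pinfty_gt.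
have pt : fine (P [set w | t * T w <= M]) < del.
  by near: t; exact: cvg_scaled_cdf0.
set D := mkset _ in pt.
have mD : measurable D.
  rewrite (_ : D = (fun w => t * T w) @^-1` `]-oo, M]); last first.
    by apply/seteqP; split => w /=; rewrite in_itv.
  rewrite -[X in measurable X]setTI.
  have mtT : measurable_fun setT (fun w => t * T w) by exact: measurable_funM.
  exact: mtT.
have intat : P.-integrable setT (EFin \o (fun w => V (a * t * T w))).
  by apply: intV; rewrite mulr_gt0.
have intt := intV _ t0.
have intD : P.-integrable setT (EFin \o (\1_D : Omega -> R)).
  exact: integrable_indic.
have intZ k (f : Omega -> R) : P.-integrable setT (EFin \o f) ->
    P.-integrable setT (EFin \o (fun w => k * f w)).
  by move=> intf; exact: (integrableZl measurableT _ intf).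
have intAdd (f g : Omega -> R) : P.-integrable setT (EFin \o f) ->
    P.-integrable setT (EFin \o g) ->
    P.-integrable setT (EFin \o (fun w => f w + g w)).
  by move=> intf intg; exact: (integrableD measurableT intf intg).
have intDE : \int[P]_w (\1_D w : R) = fine (P D).
  by rewrite /Rintegral integral_indic// setIT.
set mat := \int[P]_w _; set mt := \int[P]_w V (t * T w).
have HD w : \1_(`]-oo, M]) (t * T w) = \1_D w :> R.
  by rewrite !indicE /D; congr (_%:R); apply/idP/idP => /set_mem/=;
    rewrite ?in_itv/= => h; apply/mem_set; rewrite /= ?in_itv.
(* [up] and [lo] are the two sides of the pointwise bound at [t * T w], integrated against [P]. *)
have up : mat <= (b + e / 2) * mt + K * fine (P D).
  rewrite -intDE -!RintegralZl//.
  rewrite -RintegralD//; [|exact: intZ|exact: intZ].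
  apply: le_Rintegral => //; first by apply: (intAdd _ _); exact: intZ.
  move=> w _; have := HVK (t * T w); rewrite HD mulrA => /(le_trans (ler_norm _)).
  by lra.
have lo : b * mt <= mat + (e / 2 * mt + K * fine (P D)).
  rewrite -intDE -!RintegralZl//.
  rewrite -RintegralD//; [|exact: intZ|exact: intZ].
  rewrite -RintegralD//; last by apply: (intAdd _ _); exact: intZ.
  apply: le_Rintegral => //; first exact: intZ.
    by apply: (intAdd _ _) => //; apply: (intAdd _ _); exact: intZ.
  move=> w _; have := HVK (t * T w); rewrite HD mulrA distrC => /(le_trans (ler_norm _)).
  by lra.
(* Off [D] monotonicity gives [V M <= V (t * T w)]; on [D] the indicator term alone supplies
   [V M]. *)
have bot : V M <= mt + V M * fine (P D).
  rewrite -intDE -!RintegralZl// -RintegralD//; last exact: intZ.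
  rewrite -[leLHS]mulr1 -[X in _ * X](_ : fine (P setT) = 1); last first.
    by rewrite probability_setT.
  rewrite -Rintegral_cst//; apply: le_Rintegral => //.
  - exact: finite_measure_integrable_cst.
  - by apply: (intAdd _ _) => //; exact: intZ.
  move=> w _; rewrite indicE; have [wD|wD] := boolP (w \in D).
    by rewrite mulr1 lerDr.
  rewrite mulr0 addr0 ndV// ltW// ltNge; apply/negP => h.
  by move/negP: wD; apply; rewrite inE.
have pD0 : 0 <= fine (P D) by exact: fine_ge0.
move: pt; rewrite lt_min => /andP[pt1 pt2].
have mt_ge : V M / 2 <= mt by nra.
have Kp : K * fine (P D) <= e / 2 * (V M / 2).
  move: pt2; rewrite ltr_pdivlMr// => pt2; nra.
have mt0 : 0 < mt by apply: lt_le_trans mt_ge; rewrite divr_gt0.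
rewrite -(ler_pM2r mt0) -{2}(gtr0_norm mt0) -normrM mulrBl divfK ?gt_eqF//.
rewrite ler_norml; apply/andP; split; nra.
Unshelve. all: end_near.
Qed.

(** * Sigma-finiteness from finite tails, and Tonelli's theorem for the mixture *)

Lemma sigma_finite_tails {R : realType} (rho : {measure set R -> \bar R}) :
  rho (~` `]0, +oo[) = 0%E ->
  (forall y, 0 < y -> (tail_integral rho y < +oo)%E) ->
  sigma_finite setT rho.
Proof.
move=> rho0 rhooo.
exists (fun n => ~` `]0, +oo[ `|` `]n.+1%:R^-1, +oo[).
  apply/seteqP; split => // x _.
  have [x0|x0] := leP x 0.
    exists 0%N => //; left; rewrite /= in_itv/= andbT.
    by apply/negP; rewrite -leNgt.
  exists (Num.truncn x^-1) => //; right; rewrite /= in_itv/= andbT.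
  by rewrite invf_plt ?posrE// truncnS_gt.
move=> n; split; first by apply: measurableU => //; exact: measurableC.
rewrite (le_lt_trans (measureU2 _ _ _))//; first exact: measurableC.
by rewrite [X in (X + _)%E](_ : _ = 0%E) ?add0e; [exact: rhooo|exact: rho0].
Qed.

Lemma measurable_product_gt1 {R : realType} {d} {Omega : measurableType d}
    (T : Omega -> R) : measurable_fun setT T ->
  measurable [set q : R * Omega | 0 < q.1 /\ 1 < q.1 * T q.2].
Proof.
move=> mT.
have mTs : measurable_fun setT (fun q : R * Omega => T q.2).
  exact: measurableT_comp measurable_snd.
have mf : measurable_fun setT (fun q : R * Omega => q.1 * T q.2).
  exact: measurable_funM.
rewrite (_ : mkset _ = (fst @^-1` `]0, +oo[) `&`
  ((fun q : R * Omega => q.1 * T q.2) @^-1` `]1, +oo[)); last first.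
  by apply/seteqP; split => q /=; rewrite !in_itv/= !andbT.
apply: measurableI.
- by rewrite -[X in measurable X]setTI; exact: measurable_fst.
- by rewrite -[X in measurable X]setTI; exact: mf.
Qed.

Lemma measurable_probability_gt1 {R : realType} {d} {Omega : measurableType d}
    (P : probability Omega R) (T : Omega -> R) : measurable_fun setT T ->
  measurable_fun (`]0, +oo[%classic : set R) (fun z => P [set w | 1 < z * T w]).
Proof.
move=> /measurable_product_gt1 mE.
apply: (eq_measurable_fun (P \o xsection [set q : R * Omega | 0 < q.1 /\ 1 < q.1 * T q.2])).
  move=> z; rewrite inE/= in_itv/= andbT => z0; congr (P _).
  by apply/seteqP; split => w; rewrite /xsection/= inE/=; [case|].
by apply: measurable_funTS; exact: measurable_fun_xsection.
Qed.

(** Both sides are the product mass of the set of pairs with [0 < z] and [1 < z * T w], computed by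
    its sections in either order. *)
Lemma tonelli_tail {R : realType} {d} {Omega : measurableType d}
    (rho : {measure set R -> \bar R}) (P : probability Omega R) (T : Omega -> R) :
  sigma_finite setT rho -> measurable_fun setT T ->
  (\int[rho]_(z in `]0%R, +oo[) P [set w | (1 < z * T w)%R] =
   \int[P]_w rho [set z | 0 < z /\ 1 < z * T w]%R)%E.
Proof.
move=> sf mT.
(* [m] is [rho] itself, repackaged with its sigma-finiteness so that Tonelli's theorem applies. *)
pose H1 := isSFinite.Build _ _ _ _ (sfinite_measure_sigma_finite sf).
pose H2 := isSigmaFinite.Build _ _ _ _ sf.
pose m := HB.pack_for {sigma_finite_measure set R -> \bar R}
  (Measure.sort rho) H1 H2.
have mE := measurable_product_gt1 T mT.
set E := mkset _ in mE.
have := indic_fubini_tonelli m P mE.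
rewrite indic_fubini_tonelli_FE// indic_fubini_tonelli_GE// => H.
transitivity (\int[m]_x (P \o xsection E) x)%E; last rewrite H.
  rewrite [LHS]integral_mkcond; apply: eq_integral => z _.
  rewrite patchE; case: ifPn => [|/negP].
    rewrite inE/= in_itv/= andbT => z0; congr (P _).
    by apply/seteqP; split => w; rewrite /xsection/= inE/=; [|case].
  rewrite inE/= in_itv/= andbT => z0.
  rewrite (_ : xsection _ _ = set0) ?measure0//.
  by apply/seteqP; split => // w; rewrite /xsection/= inE/= => -[/z0].
apply: eq_integral => w _ /=; congr (rho _).
by apply/seteqP; split => z; rewrite /ysection/= inE/=.
Qed.

(** * Tails of the marginals as finite mixtures *)

Lemma bounded_measure_lty {R : realType} {X : polishType R}
    (nu : {measure set (R * borel X) -> \bar R}) (rho : {measure set R -> \bar R})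
    (alpha : {measure set (borel X) -> \bar R}) (B : set (borel X)) (y : R) :
  levy_intensity nu -> homogeneous nu rho alpha ->
  measurable B -> metric_bounded (B : set X) ->
  0 < y -> (0 < tail_integral rho y)%E -> (alpha B < +oo)%E.
Proof.
move=> [_ nulty] [_ nuE] mB bB y0 rhoy; rewrite ltey; apply/eqP => aoo.
have := nulty B mB bB; rewrite ltNge => /negP; apply.
have mmin (D : set (R * borel X)) : measurable_fun D (fun p => (Num.min 1 p.1)%:E).
  apply/measurable_EFinP; apply: measurable_funTS; apply: measurable_minr => //.
(* If [alpha B] were infinite, the part of the Lévy integral above [y] would already be infinite:
   the integrand is at least [Num.min 1 y] there, and the tail of [rho] at [y] is positive. *)
apply: (@le_trans _ _ (\int[nu]_(p in `]y, +oo[ `*` B) (cst (Num.min 1 y)%:E) p))%E.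
  rewrite integral_cst; last exact: measurableX.
  rewrite nuE// aoo gt0_muley// gt0_muley// lte_fin lt_min ltr01//.
apply: (@le_trans _ _ (\int[nu]_(p in `]y, +oo[ `*` B) (Num.min 1 p.1)%:E))%E.
  apply: ge0_le_integral => //.
  - exact: measurableX.
  - by move=> p _; rewrite lee_fin le_min ler01 ltW.
  - move=> p [/=]; rewrite in_itv/= andbT => yp _.
    by rewrite lee_fin le_min ge_min lexx/= ge_min (ltW yp) orbT.
apply: ge0_subset_integral => //; try exact: measurableX.
- by move=> p [/=]; rewrite in_itv/= andbT => p0 _; rewrite lee_fin le_min ler01 ltW.
- move=> p [/= + Bp]; rewrite in_itv/= andbT => yp; split => //.
  by rewrite /= in_itv/= andbT (lt_trans y0).
Qed.

(** Evaluating the marginal intensity on the rectangle over [B] in two ways gives both sides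
    multiplied by [alpha B], which cancels because it is positive and finite. *)
Lemma corm_marginal_tail {R : realType} {X : polishType R} {d : nat}
    (h : d.-tuple R -> R)
    (nu : {measure set (R * borel X)%type -> \bar R})
    (rho : {measure set R -> \bar R})
    (alpha : {measure set (borel X) -> \bar R})
    {disp : measure_display} {Omega : measurableType disp}
    (P : probability Omega R) (j : 'I_d) (S : {RV P >-> R})
    (rho_j : {measure set R -> \bar R}) (B : set (borel X)) (t : R) :
  score_density h -> homogeneous nu rho alpha ->
  measurable B -> (0 < alpha B < +oo)%E ->
  (forall A : set R, measurable A -> distribution P S A = marginal_law h j A) ->
  homogeneous (corm_marginal h nu j) rho_j alpha -> 0 < t ->
  tail_integral rho_j t^-1 =
    (\int[rho]_(z in `]0%R, +oo[) P [set w | (1 < z * (t * S w))%R])%E.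
Proof.
move=> hh hnu mB /andP[aB0 aBoo] PS [_ hj] t0.
have mtS : measurable_fun setT (fun w => t * S w) by exact: measurable_funM.
have aBfin : alpha B \is a fin_num by rewrite ge0_fin_numE.
have mA : measurable (`]t^-1, +oo[%classic : set R) by [].
have := hj _ _ mA mB; rewrite corm_marginal_rectangle//.
rewrite (_ : (\int[nu]_(p in _) _)%E =
  (\int[nu]_(p in `]0%R, +oo[ `*` B) P [set w | (1 < p.1 * (t * S w))%R])%E); last first.
  apply: eq_integral => -[z x]; rewrite inE => -[/=].
  rewrite in_itv/= andbT => z0 _.
  rewrite -PS; last first.
    rewrite (_ : mkset _ = ( *%R z) @^-1` `]t^-1, +oo[)//.
    by rewrite -[X in measurable X]setTI; exact: mulrl_measurable.
  rewrite /distribution /pushforward; congr (P _); apply/seteqP.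
  split => w /=; rewrite in_itv/= andbT => H.
    by rewrite mulrCA -ltr_pdivrMl// mulr1.
  by rewrite -[t^-1]mulr1 ltr_pdivrMl// mulrCA.
rewrite (ge0_integral_homogeneous nu rho alpha `]0, +oo[ B
  (fun z => P [set w | 1 < z * (t * S w)]))//; last first.
  exact: measurable_probability_gt1.
have cancel u : u = (((fine (alpha B))^-1)%:E * (u * alpha B))%E.
  rewrite -(fineK aBfin)/= (muleC u) muleA -EFinM mulVf ?mul1e//.
  by rewrite gt_eqF// fine_gt0// aB0.
by move=> H; rewrite (cancel (tail_integral _ _)) -H (muleC (alpha B)) -cancel.
Qed.

(** The integral is split at [z = 1]. Above 1 the integrand is at most 1 and [rho] is finite; below
    1 it is dominated by the probability in the assumed [nu]-integral, and the positive factor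
    [alpha B] is removed. *)
Lemma tail_mixture_lty {R : realType} {X : polishType R}
    (nu : {measure set (R * borel X) -> \bar R}) (rho : {measure set R -> \bar R})
    (alpha : {measure set (borel X) -> \bar R})
    {disp : measure_display} {Omega : measurableType disp}
    (P : probability Omega R) (T : {RV P >-> R}) (B : set (borel X)) :
  homogeneous nu rho alpha ->
  (forall y, 0 < y -> (tail_integral rho y < +oo)%E) ->
  measurable B -> (0 < alpha B < +oo)%E ->
  (\int[nu]_(p in `]0%R, 1%R[ `*` B) P [set w | (p.1^-1 <= T w)%R] < +oo)%E ->
  (\int[rho]_(z in `]0%R, +oo[) P [set w | (1 < z * T w)%R] < +oo)%E.
Proof.
move=> hnu rhooo mB /andP[aB0 aBoo] hint.
pose g z := P [set w | 1 < z * T w].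
pose k (z : R) := P [set w | z^-1 <= T w].
have mT (A : set R) : measurable A -> measurable (T @^-1` A).
  by move=> mA; rewrite -[X in measurable X]setTI; exact: measurable_funP.
have mTge y : measurable [set w | y <= T w].
  rewrite (_ : mkset _ = T @^-1` `[y, +oo[); first exact: mT.
  by apply/seteqP; split => w /=; rewrite in_itv/= andbT.
have mTgt z : measurable [set w | 1 < z * T w].
  rewrite (_ : mkset _ = T @^-1` (( *%R z) @^-1` `]1, +oo[)); last first.
    by apply/seteqP; split => w /=; rewrite in_itv/= andbT.
  by apply: mT; rewrite -[X in measurable X]setTI; exact: mulrl_measurable.
have mg : measurable_fun (`]0, +oo[%classic : set R) g.
  exact: measurable_probability_gt1.
have mk : measurable_fun (`]0, 1[%classic : set R) k.
  (* Extending by 0 to the left keeps the function monotone on the whole line, and monotone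
     functions are measurable. *)
  pose k0 z : R := if 0 < z then fine (k z) else 0.
  apply: (eq_measurable_fun (EFin \o k0)) => [z|].
    rewrite inE/= in_itv/= /k0 => /andP[-> _].
    by rewrite fineK// fin_num_measure.
  apply/measurable_EFinP; apply: nondecreasing_measurable => // y z yz.
  rewrite /k0; case: ifPn => [y0|_]; last by case: ifPn => // _; exact: fine_ge0.
  have z0 := lt_le_trans y0 yz.
  rewrite z0 fine_le ?fin_num_measure// le_measure ?inE// => w /=.
  by apply: le_trans; rewrite lef_pV2.
have -> : `]0, +oo[%classic = `]0, 1[%classic `|` `[1, +oo[%classic :> set R.
  apply/seteqP; split => z /=; rewrite !in_itv/= ?andbT.
    by move=> z0; have [z1|z1] := ltP z 1; [left|right] => //; apply/andP.
  by move=> [/andP[]//|]; exact: lt_le_trans.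
have s01 : (`]0, 1[%classic : set R) `<=` `]0, +oo[.
  by move=> z; rewrite /= !in_itv/= andbT => /andP[].
have s1oo : (`[1, +oo[%classic : set R) `<=` `]0, +oo[.
  by move=> z; rewrite /= !in_itv/= !andbT; exact: lt_le_trans.
rewrite ge0_integral_setU//; last 2 first.
- apply/measurable_funU => //; split; exact: measurable_funS mg.
- apply/disj_setPS => z [] /=; rewrite !in_itv/= andbT => /andP[_ z1].
  by rewrite leNgt z1.
rewrite lte_add_pinfty//; last first.
  apply: (@le_lt_trans _ _ (\int[rho]_(z in `[1%R, +oo[) cst 1 z)%E).
    apply: ge0_le_integral => //; first exact: measurable_funS mg.
    by move=> z _; exact: probability_le1.
  (* Tail integrals are over open half-lines, so the closed one from 1 is enclosed in the open one
     from [1 / 2]. *)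
  rewrite integral_cst// mul1e (le_lt_trans _ (rhooo (1 / 2) _))//.
  rewrite le_measure ?inE// => z /=; rewrite !in_itv/= !andbT.
  by apply: lt_le_trans; rewrite ltr_pdivrMr// mul1r ltr1n.
have : (\int[nu]_(p in `]0%R, 1%R[ `*` B) g p.1 < +oo)%E.
  apply: le_lt_trans hint; apply: ge0_le_integral => //.
  - exact: measurableX.
  - apply: (measurable_comp (measurable_itv `]0%R, 1%R[) _ (measurable_funS _ s01 mg)) => //.
      by move=> _ [p [p1 _] <-].
    exact: measurable_funTS.
  - apply: (measurable_comp (measurable_itv `]0%R, 1%R[) _ mk) => //.
      by move=> _ [p [p1 _] <-].
    exact: measurable_funTS.
  move=> p [/=]; rewrite in_itv/= => /andP[p0 p1] _.
  rewrite le_measure ?inE// => w /=.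
  by rewrite -ltr_pdivrMl// mulr1 => /ltW.
rewrite (ge0_integral_homogeneous nu rho alpha)//; last first.
  exact: measurable_funS mg.
apply: contraTT; rewrite -!leNgt !leye_eq => /eqP ->.
by rewrite gt0_muley.
Qed.

(** * Regular variation of the marginals *)

Theorem theorem3 (R : realType) (X : polishType R) (d : nat)
    (h : d.-tuple R -> R)
    (nu : {measure set (R * borel X)%type -> \bar R})
    (rho : {measure set R -> \bar R})
    (alpha : {measure set (borel X) -> \bar R})
    (disp : measure_display) (Omega : measurableType disp)
    (P : probability Omega R) (S : 'I_d -> {RV P >-> R})
    (rho_ : 'I_d -> {measure set R -> \bar R}) :
  (0 < d)%N ->
  score_density h ->
  levy_intensity nu ->
  homogeneous nu rho alpha ->
  (0 < alpha setT)%E ->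
  (forall (j : 'I_d) (A : set R), measurable A ->
     distribution P (S j) A = marginal_law h j A) ->
  (forall (j : 'I_d) (B : set (borel X)),
     measurable B -> metric_bounded (B : set X) ->
     (\int[nu]_(p in `]0%R, 1%R[ `*` B)
        P [set w | (p.1^-1 <= S j w)%R] < +oo)%E /\
     (\int[nu]_(p in `[1%R, +oo[ `*` B)
        (P [set w | (S j w <= p.1^-1)%R] * p.1%:E) < +oo)%E) ->
  (forall j : 'I_d, homogeneous (corm_marginal h nu j) (rho_ j) alpha) ->
  regularly_varying rho ->
  forall j : 'I_d, regularly_varying (rho_ j).
Proof.
move=> _ hh levy hnu aT PS hint hj [sigma [sigma01 [L [svL tailE]]]] j.
have rho0 : rho (~` `]0, +oo[) = 0%E by case: hnu.
have tail_lty y : 0 < y -> (tail_integral rho y < +oo)%E.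
  by move=> /tailE ->; exact: ltry.
pose T := S j.
(* [E x] is the section met in Tonelli's theorem: a tail half-line for positive [x] and empty
   otherwise, so that [V] is monotone on the whole line. *)
pose E x := [set z : R | 0 < z /\ 1 < z * x].
pose V x := fine (rho (E x)).
have EE x : 0 < x -> E x = `]x^-1, +oo[%classic.
  move=> x0; apply/seteqP; split => z; rewrite /E /= in_itv/= andbT.
    by move=> [_]; rewrite -ltr_pdivrMr// mul1r.
  move=> xz; split; first by rewrite (lt_trans _ xz)// invr_gt0.
  by rewrite -ltr_pdivrMr// mul1r.
have E0 x : x <= 0 -> E x = set0.
  move=> x0; apply/seteqP; split => // z [z0 /=]; apply/negP.
  by rewrite -leNgt (le_trans _ ler01)// mulr_ge0_le0// ltW.
have mE x : measurable (E x).
  by have [x0|x0] := leP x 0; [rewrite E0|rewrite EE].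
have VE x : (V x)%:E = rho (E x).
  rewrite fineK// ge0_fin_numE//; have [x0|x0] := leP x 0.
    by rewrite E0// measure0.
  by rewrite EE// tail_lty// invr_gt0.
have VL x : 0 < x -> V x = L x * x `^ sigma.
  move=> x0; rewrite /V EE// -[rho _]/(tail_integral rho x^-1) tailE ?invr_gt0//=.
  by rewrite invrK -powR_inv1 ?(ltW x0)// -powRrM mulN1r opprK.
have V0 x : 0 <= V x by exact: fine_ge0.
have ndV : {homo V : x y / x <= y}.
  move=> x y xy; rewrite -lee_fin !VE le_measure ?inE// => z [z0 zx].
  by split => //; rewrite (lt_le_trans zx)// ler_pM2l.
have mV : measurable_fun setT V by exact: nondecreasing_measurable.
(* By [VL] the ratio eventually equals [L (a * x) / L x] times the constant power of [a]. *)
have cvgV a : 0 < a -> V (a * x) / V x @[x --> +oo] --> a `^ sigma.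
  move=> a0; rewrite -[a `^ sigma]mul1r.
  apply: cvg_trans (cvgM (svL a a0) (cvg_cst (a `^ sigma))).
  apply: near_eq_cvg; near=> x.
  have x0 : 0 < x by near: x; exact: nbhs_pinfty_gt.
  rewrite /= !VL ?mulr_gt0// powRM ?(ltW x0) ?(ltW a0)//.
  have xs : x `^ sigma != 0 by rewrite gt_eqF// powR_gt0.
  by rewrite mulrA -mulf_div divff// mulr1 mulrAC.
(* Slow variation with [a = 1] forces [L] to be eventually nonzero: since the inverse of 0 is 0, a
   zero of [L] would make the ratio 0, at distance 1 from its limit. *)
have [x0 x0_gt0 Vx0] : exists2 x, 0 < x & 0 < V x.
  have /cvgrPdist_lt/(_ _ ltr01)[M [_ HM]] := svL 1 ltr01.
  pose x := Num.max 1 (M + 1).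
  have x0 : 0 < x by rewrite lt_max ltr01.
  exists x => //; rewrite lt_neqAle V0 andbT eq_sym VL//.
  rewrite mulf_neq0//; last by rewrite gt_eqF// powR_gt0.
  apply/eqP => Lx; have /= := HM x; rewrite mul1r Lx invr0 mulr0 subr0 normr1 ltxx.
  by move=> /(_ _)/notF; apply; rewrite lt_max ltrDl ltr01 orbT.
(* A single bounded set of positive finite mass lets [rho_ j] be read off the marginal intensity; a
   vanishing [alpha] would leave it undetermined. *)
have [B [mB bB aB0]] := exists_bounded_measure_gt0 alpha aT.
have aBoo : (alpha B < +oo)%E.
  apply: (bounded_measure_lty nu rho alpha B x0^-1) => //; first by rewrite invr_gt0.
  by rewrite /tail_integral -EE// -VE lte_fin.
have aB : (0 < alpha B < +oo)%E by rewrite aB0.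
(* The marginal law integrates over the positive orthant, where no coordinate is nonpositive. *)
have PT0 : P [set w | T w <= 0] = 0%E.
  have := PS j `]-oo, 0%R]%classic (measurable_itv _).
  rewrite /distribution /pushforward => H.
  transitivity (marginal_law h j `]-oo, 0%R]); first by rewrite -H; congr (P _).
  rewrite /marginal_law (_ : _ `&` _ = set0) ?integral_set0//.
  apply/seteqP; split => // s [s0 /=]; rewrite in_itv/= leNgt.
  by rewrite s0.
have sf := sigma_finite_tails rho rho0 tail_lty.
have tail_mixture (t : R) : 0 < t ->
    tail_integral (rho_ j) t^-1 = (\int[P]_w (V (t * T w))%:E)%E.
  move=> t0; rewrite (corm_marginal_tail h nu rho alpha P j T _ B t hh hnu mB aB (PS j) (hj j))//.
  rewrite tonelli_tail//; last exact: measurable_funM.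
  by apply: eq_integral => w _; rewrite VE.
have mVt t : measurable_fun setT (fun w => V (t * T w)).
  by apply: measurableT_comp => //; exact: measurable_funM.
have tail1 : (\int[P]_w (V (T w))%:E < +oo)%E.
  have : (\int[P]_w (V (1 * T w))%:E < +oo)%E.
    rewrite -tail_mixture//.
    rewrite (corm_marginal_tail _ _ _ _ P _ _ _ B 1 hh hnu mB aB (PS j) (hj j))//.
    under eq_integral do under eq_set do rewrite mul1r.
    by apply: (tail_mixture_lty nu rho alpha P T B) => //; case: (hint j B mB bB).
  by under eq_integral do rewrite mul1r.
have intV1 : P.-integrable setT (EFin \o (fun w => V (T w))).
  apply/integrableP; split; first exact/measurable_EFinP/measurableT_comp.
  by under eq_integral do rewrite /= ger0_norm//.
have intV t : 0 < t -> P.-integrable setT (EFin \o (fun w => V (t * T w))).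
  by move=> t0; exact: (integrable_scaled P T V t (t `^ sigma) x0 t0 ndV V0 Vx0 (cvgV t t0)).
pose m t := (\int[P]_w V (t * T w))%R.
have mtE t : 0 < t -> tail_integral (rho_ j) t^-1 = (m t)%:E.
  move=> t0; rewrite tail_mixture// /m /Rintegral fineK//.
  by apply: integrable_fin_num => //; exact: intV.
(* The index is preserved; the slowly varying part is forced by solving the tail formula for it at
   [t = y^-1]. *)
exists sigma; split => //; exists (fun t => m t * t `^ (- sigma)); split; last first.
  move=> y y0; rewrite -{1}(invrK y) mtE ?invr_gt0//; congr (_%:E).
  rewrite -mulrA -powRM ?invr_ge0 ?(ltW y0)// mulVf ?gt_eqF//.
  by rewrite powR1 mulr1.
move=> a a0.
have := mixture_ratio_cvg P T V a (a `^ sigma) x0 a0 ndV V0 Vx0 (cvgV a a0) PT0 intV.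
move=> cvgm; rewrite -[X in _ --> X](_ : a `^ sigma * a `^ (- sigma) = 1); last first.
  by rewrite -powRD ?subrr ?powRr0//; apply/implyP => _; rewrite gt_eqF.
apply: cvg_trans (cvgM cvgm (cvg_cst (a `^ (- sigma)))).
apply: near_eq_cvg; near=> t.
have t0 : 0 < t by near: t; exact: nbhs_pinfty_gt.
rewrite /= powRM ?(ltW t0) ?(ltW a0)//.
have ts : t `^ (- sigma) != 0 by rewrite gt_eqF// powR_gt0.
by rewrite mulrA -mulf_div divff// mulr1 mulrAC.
Unshelve. all: end_near.
Qed.
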